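(* Let Assumptions 1, 2 and 3 hold, with $W_N\in\mathbb{R}^{N\times\bar N}$. Then every matrix $Z\in\mathbb{R}^{2n\times\bar N}$ satisfying \[\bar\Delta_NZ^\top+Z\bar\Delta_N^\top\prec 0,\qquad Z\bar\Phi_N^\top+\bar\Phi_NZ^\top\succ 0,\qquad Z\bar\Phi_N^\top-\bar\Phi_NZ^\top=0_{2n,2n}\] is such that $Z\bar\Phi_N^\top$ is invertible and the gain $K_{\mathrm f}=\bar\Upsilon_NZ^\top(Z\bar\Phi_N^\top)^{-1}$ makes $A_{\mathrm f}+B_{\mathrm f}K_{\mathrm f}$ Hurwitz. Conversely, if $K_{\mathrm f}\in\mathbb{R}^{1\times 2n}$ is such that $A_{\mathrm f}+B_{\mathrm f}K_{\mathrm f}$ is Hurwitz, then $K_{\mathrm f}=\bar\Upsilon_NZ^\top(Z\bar\Phi_N^\top)^{-1}$ for some $Z$ satisfying the three conditions above.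
   Context: Fix $n\ge 1$ and real numbers $a_1,\dots,a_n,b_1,\dots,b_n$. The plant is the continuous-time SISO system $y^{(n)}+a_1y^{(n-1)}+\dots+a_ny=b_1u^{(n-1)}+\dots+b_nu$, represented in observability canonical form $\dot x=Ax+Bu$, $y=Cx$, $x(t)\in\mathbb{R}^n$, $x(0)=x_0$, where $C=[0_{1,n-1}\;1]$, $A$ is the $n\times n$ matrix whose first $n-1$ columns are $\begin{bmatrix}0_{1,n-1}\\ I_{n-1}\end{bmatrix}$ and whose last column is $(-a_n,\dots,-a_1)^\top$, and $B=(b_n,\dots,b_1)^\top$; a locally integrable input $u$ is applied on $[0,t_N]$. Assumption 1: the polynomials $s^n+a_1s^{n-1}+\dots+a_n$ and $b_1s^{n-1}+\dots+b_n$ are coprime. For real parameters $c_1,\dots,c_n,\beta$, $A_{\mathrm r}\in\mathbb{R}^{n\times n}$ is the matrix whose first $n-1$ rows are $[0_{n-1,1}\;I_{n-1}]$ and whose last row is $(-c_n,\dots,-c_1)$, and $B_{\mathrm r}=(0,\dots,0,1)^\top\in\mathbb{R}^n$. Assumption 2: $-\beta$ is not an eigenvalue of $A_{\mathrm r}$. The filters are $\dot\zeta=A_{\mathrm r}\zeta+B_{\mathrm r}u$, $\zeta(0)=0$; $\dot\mu=A_{\mathrm r}\mu+B_{\mathrm r}y$, $\mu(0)=0$; $\chi=\mathrm{col}(\zeta,\mu)\in\mathbb{R}^{2n}$; $\dot\phi=-\beta\phi+\chi$, $\phi(0)=0_{2n,1}$; $\dot\upsilon=-\beta\upsilon+u$,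 $\upsilon(0)=0$; $\delta=\chi-\beta\phi$. Define $A_{\mathrm f}=\begin{bmatrix}A_{\mathrm r}&0_{n,n}\\ L_b& A_a\end{bmatrix}\in\mathbb{R}^{2n\times 2n}$, where $L_b\in\mathbb{R}^{n\times n}$ has all rows zero except the last, which equals $(b_n,\dots,b_1)$, and $A_a\in\mathbb{R}^{n\times n}$ has first $n-1$ rows $[0_{n-1,1}\;I_{n-1}]$ and last row $(-a_n,\dots,-a_1)$; $B_{\mathrm f}=\mathrm{col}(0_{n-1,1},1,0_{n,1})\in\mathbb{R}^{2n}$; $G_{\mathrm f}\in\mathbb{R}^{2n\times n}$ is the matrix whose only nonzero entry is a $1$ in position $(2n,n)$. Let $\Gamma^\star=G_{\mathrm f}(A_{\mathrm r}^\top+\beta I_n)^{-1}$ and $\epsilon(t)=\Gamma^\star(\mathrm{e}^{A_{\mathrm r}^\top t}-\mathrm{e}^{-\beta t}I_n)x_0$. For sampling times $0<t_1<\dots<t_N$ let $\Delta_N=[\delta(t_1)\cdots\delta(t_N)]$, $\Phi_N=[\phi(t_1)\cdots\phi(t_N)]\in\mathbb{R}^{2n\times N}$, $\Upsilon_N=[\upsilon(t_1)\cdots\upsilon(t_N)]\in\mathbb{R}^{1\times N}$, $E_N=[\epsilon(t_1)\cdots\epsilon(t_N)]$. Assumption 3: there is $W_N\in\mathbb{R}^{N\times\bar N}$ with $E_NW_N=0_{2n,\bar N}$ such that, with $\bar\Delta_N=\Delta_NW_N$, $\bar\Phi_N=\Phi_NW_N$, $\bar\Upsilon_N=\Upsilon_NW_N$,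 one has $\mathrm{rank}(\mathrm{col}(\bar\Phi_N,\bar\Upsilon_N))=2n+1$. $\prec 0$ / $\succ 0$ denote negative/positive definiteness of symmetric matrices; a matrix is Hurwitz if all its eigenvalues have negative real part. *)

(* Defs.v *)
From HB Require Import structures.
From mathcomp Require Import all_boot all_order all_algebra.
From mathcomp Require Import all_classical all_reals all_analysis.
From mathcomp.real_closed Require Import complex.
Set Implicit Arguments. Unset Strict Implicit. Unset Printing Implicit Defensive.
Import Order.TTheory GRing.Theory Num.Theory numFieldNormedType.Exports.
Local Open Scope ring_scope.

Section Defs.
Variable R : realType.

(* Coefficients a_k, b_k, c_k (k = 1..n) are given as functions nat -> R,
   a k standing for a_k. *)

(* Observability canonical form: first n-1 columns [0_{1,n-1}; I_{n-1}],
   last column (-a_n, ..., -a_1)^T. *)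
Definition plantA (n : nat) (a : nat -> R) : 'M[R]_n :=
  \matrix_(i < n, j < n)
    if (j.+1 < n)%N then ((i : nat) == j.+1)%:R else - a (n - i)%N.
Definition plantB (n : nat) (b : nat -> R) : 'cV[R]_n :=
  \col_(i < n) b (n - i)%N.
Definition plantC (n : nat) : 'rV[R]_n := \row_(j < n) ((j : nat) == n.-1)%:R.

Definition companion (n : nat) (c : nat -> R) : 'M[R]_n :=
  \matrix_(i < n, j < n)
    if (i.+1 < n)%N then ((j : nat) == i.+1)%:R else - c (n - j)%N.
Definition Br (n : nat) : 'cV[R]_n := \col_(i < n) ((i : nat) == n.-1)%:R.
Definition Lb (n : nat) (b : nat -> R) : 'M[R]_n :=
  \matrix_(i < n, j < n) if (i : nat) == n.-1 then b (n - j)%N else 0.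

Definition Af (n : nat) (a b c : nat -> R) : 'M[R]_(n + n) :=
  block_mx (companion n c) 0 (Lb n b) (companion n a).
Definition Bf (n : nat) : 'cV[R]_(n + n) := col_mx (Br n) 0.
Definition Gf (n : nat) : 'M[R]_(n + n, n) :=
  \matrix_(i < n + n, j < n) (((i : nat) == (n + n).-1) && ((j : nat) == n.-1))%:R.

Definition den_poly (n : nat) (a : nat -> R) : {poly R} :=
  'X^n + \sum_(1 <= k < n.+1) a k *: 'X^(n - k).
Definition num_poly (n : nat) (b : nat -> R) : {poly R} :=
  \sum_(1 <= k < n.+1) b k *: 'X^(n - k).

Definition mexp (n : nat) (M : 'M[R]_n) (t : R) : 'M[R]_n :=
  limn (series (fun k : nat => (t ^+ k / (k`!)%:R) *: M ^+ k)).

(* x is a (Caratheodory) solution on [0, T] of x' = A x + B v, x(0) = x0,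
   written componentwise in integral form with Lebesgue integrals. *)
Definition ode_sol (n m : nat) (A : 'M[R]_n) (B : 'M[R]_(n, m))
    (v : R -> 'cV[R]_m) (x0 : 'cV[R]_n) (T : R) (x : R -> 'cV[R]_n) : Prop :=
  forall t : R, 0 <= t <= T -> forall i : 'I_n,
    (@lebesgue_measure R).-integrable `[0, t]
        (EFin \o (fun s => (A *m x s + B *m v s) i 0)) /\
    x t i 0 = x0 i 0 +
      \int[@lebesgue_measure R]_(s in `[0, t]) ((A *m x s + B *m v s) i 0).

Definition posdef (k : nat) (M : 'M[R]_k) : Prop :=
  M^T = M /\ forall v : 'cV[R]_k, v != 0 -> 0 < (v^T *m M *m v) 0 0.
Definition negdef (k : nat) (M : 'M[R]_k) : Prop := posdef (- M).

Definition hurwitz (k : nat) (M : 'M[R]_k) : Prop :=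
  forall z : R[i], eigenvalue (map_mx (fun x : R => (x%:C)%C) M) z ->
    complex.Re z < 0.

Definition samples (m N : nat) (f : R -> 'cV[R]_m) (ts : 'I_N -> R)
  : 'M[R]_(m, N) := \matrix_(i < m, k < N) f (ts k) i 0.

End Defs.

(* Main.v *)
(* The signal e = x - P mu - Q zeta, where P and Q intertwine the companion
   matrix A_r and its transpose, solves e' = A_r^T e, e(0) = x0; hence
   chi' = A_f chi + B_f u + G_f e, and filtering this relation through
   1/(s + beta) gives delta = A_f phi + B_f ups + eps.  Right multiplication by
   W_N cancels eps, so that DeltaB = A_f PhiB + B_f UpsB.  With S = Z PhiB^T and
   K S = UpsB Z^T, the three conditions on Z are the Lyapunov inequality for
   A_f + B_f K with certificate S; conversely, the rank condition lets one solve
   PhiB Z^T = S, UpsB Z^T = K S for any prescribed K and S. *)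
Require Import Defs.
From HB Require Import structures.
From mathcomp Require Import all_boot all_order all_algebra.
From mathcomp Require Import all_classical all_reals all_analysis.
From mathcomp.real_closed Require Import complex.
From mathcomp Require Import ring lra.
Import Order.TTheory GRing.Theory Num.Theory numFieldNormedType.Exports.
Local Open Scope ring_scope.
Set Implicit Arguments. Unset Strict Implicit. Unset Printing Implicit Defensive.

(** * Linear differential equations in integral form *)

Section LinearODE.
Context {R : realType}.
Local Notation mu := (@lebesgue_measure R).

(* Integral form of [f' = g, f 0 = x0]; [ode_sol A B v x0 T x] unfolds to
   [primitive T x0 x (fun s => A *m x s + B *m v s)]. *)
Definition primitive n (T : R) (x0 : 'cV[R]_n) (f g : R -> 'cV[R]_n) : Prop :=
  forall t : R, 0 <= t <= T -> forall i : 'I_n,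
    mu.-integrable `[0, t] (EFin \o (fun s => g s i 0)) /\
    f t i 0 = x0 i 0 + \int[mu]_(s in `[0, t]) g s i 0.

Lemma eq_primitive n (T : R) (x0 : 'cV[R]_n) f f' g g' :
  f =1 f' -> g =1 g' -> primitive T x0 f g -> primitive T x0 f' g'.
Proof. by move=> /funext<- /funext<-. Qed.

Lemma primitiveD n (T : R) (x0 y0 : 'cV[R]_n) f g h k :
  primitive T x0 f g -> primitive T y0 h k ->
  primitive T (x0 + y0) (fun t => f t + h t) (fun t => g t + k t).
Proof.
move=> fg hk t tT i; have [ig ft] := fg t tT i; have [ik ht] := hk t tT i.
have E : (fun s => (g s + k s) i 0) = (fun s => g s i 0 + k s i 0).
  by apply/funext => s; rewrite mxE.
split; last by rewrite !mxE E ft ht RintegralD// addrACA.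
by rewrite E; have := @integrableD _ _ _ mu _ (measurable_itv _) _ _ ig ik.
Qed.

Lemma primitiveM m n (T : R) (P : 'M[R]_(m, n)) (x0 : 'cV[R]_n) f g :
  primitive T x0 f g ->
  primitive T (P *m x0) (fun t => P *m f t) (fun t => P *m g t).
Proof.
move=> fg t tT i.
have E : EFin \o (fun s => (P *m g s) i 0) =
    (fun s => (\sum_(j < n) (P i j * g s j 0)%:E)%E).
  by apply/funext => s /=; rewrite mxE sumEFin.
have intP j : mu.-integrable `[0, t] (fun s => (P i j * g s j 0)%:E).
  by have := @integrableZl _ _ _ mu _ (measurable_itv _) (P i j) _ (fg t tT j).1.
split; first by rewrite E; apply: integrable_sum.
rewrite /Rintegral -/(comp EFin _) E integral_sum//.
rewrite !mxE (eq_bigr (fun j => P i j * x0 j 0 + P i j *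
   \int[mu]_(s in `[0, t]) g s j 0)).
  rewrite big_split/=; congr (_ + _).
  have -> : (\sum_(j < n) \int[mu]_(x in `[0%R, t]) (P i j * g x j 0)%:E)%E =
    (\sum_(j < n) ((P i j * \int[mu]_(s in `[0, t]) g s j 0)%R)%:E)%E.
    apply: eq_bigr => j _.
    rewrite -RintegralZl//; last exact: (fg t tT j).1.
    by rewrite fineK// integrable_fin_num.
  by rewrite sumEFin.
by move=> j _; rewrite (fg t tT j).2 mulrDr.
Qed.

Lemma primitiveZ n (T k : R) (x0 : 'cV[R]_n) f g : primitive T x0 f g ->
  primitive T (k *: x0) (fun t => k *: f t) (fun t => k *: g t).
Proof.
move=> /(primitiveM k%:M); rewrite mul_scalar_mx.
by apply: eq_primitive => t; rewrite mul_scalar_mx.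
Qed.

Lemma primitiveB n (T : R) (x0 y0 : 'cV[R]_n) f g h k :
  primitive T x0 f g -> primitive T y0 h k ->
  primitive T (x0 - y0) (fun t => f t - h t) (fun t => g t - k t).
Proof.
move=> fg /(primitiveZ (-1)) /(primitiveD fg); rewrite scaleN1r.
by apply: eq_primitive => t; rewrite scaleN1r.
Qed.

Lemma primitive_col_mx m n (T : R) (x0 : 'cV[R]_m) (y0 : 'cV[R]_n) f g h k :
  primitive T x0 f g -> primitive T y0 h k ->
  primitive T (col_mx x0 y0) (fun t => col_mx (f t) (h t))
    (fun t => col_mx (g t) (k t)).
Proof.
move=> fg hk t tT i.
case: (splitP i) => j ij; [have := fg t tT j|have := hk t tT j].
  have -> : i = lshift n j by apply/val_inj.
  rewrite !col_mxEu (_ : (fun s => g s j 0) = fun s =>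
    col_mx (g s) (k s) (lshift n j) 0)//.
  by apply/funext => s; rewrite col_mxEu.
have -> : i = rshift m j by apply/val_inj.
rewrite !col_mxEd (_ : (fun s => k s j 0) = fun s =>
  col_mx (g s) (k s) (rshift m j) 0)//.
by apply/funext => s; rewrite col_mxEd.
Qed.

Lemma primitive_cst n (T : R) (v : 'cV[R]_n) :
  primitive T v (fun=> v) (fun=> 0).
Proof.
move=> t tT i; split.
  have -> : EFin \o (fun=> (0 : 'cV[R]_n) i 0) = cst (0%:E : \bar R) :> (R -> \bar R).
    by apply/funext => s; rewrite /= mxE.
  exact: integrable0.
rewrite (@eq_Rintegral _ _ _ _ _ (cst 0)); last by move=> s _; rewrite mxE.
by rewrite Rintegral_cst// mul0r addr0.
Qed.

(** * Taylor expansion of solutions and the matrix exponential *)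

Lemma continuous_exp_coeff k : continuous (fun t : R => exp_coeff t k).
Proof.
move=> t; apply: differentiable_continuous; apply/derivable1_diffP.
by apply: derivableM; [exact: exprn_derivable|exact: derivable_cst].
Qed.

Lemma derive_exp_coeff k (t : R) :
  derive1 (fun s => exp_coeff s k.+1) t = exp_coeff t k.
Proof.
rewrite derive1E /exp_coeff /=.
rewrite (_ : (fun s : R => _) = k.+1`!%:R^-1 \*: (fun s : R => s ^+ k.+1)); last first.
  by apply/funext => s; rewrite mulrC.
rewrite deriveZ//; last exact: exprn_derivable.
rewrite -derive1E exp_derive1 /= factS natrM invfM.
by rewrite /GRing.scale/= mulrACA mulVf ?pnatr_eq0// mul1r mulrC.
Qed.

Lemma integral_exp_coeff k (t : R) : 0 <= t ->
  mu.-integrable `[0, t] (EFin \o (fun s => exp_coeff s k)) /\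
  \int[mu]_(s in `[0, t]) exp_coeff s k = exp_coeff t k.+1.
Proof.
move=> t0; have cont := continuous_exp_coeff.
have cw m u : {within `[0, u], continuous (fun s : R => exp_coeff s m)}%classic.
  by apply: continuous_subspaceT => s; exact: cont.
split.
  by apply: continuous_compact_integrable; [exact: segment_compact|exact: cw].
(* The fundamental theorem of calculus is applied on an interval with [0 < t], so the degenerate
   interval is settled first. *)
have [->|tn0] := eqVneq t 0.
  by rewrite set_itv1 Rintegral_set1 /exp_coeff /= expr0n mul0r.
rewrite /Rintegral (@continuous_FTC2 _ _ (fun s => exp_coeff s k.+1))//.
- by rewrite /= /exp_coeff /= expr0n mul0r subr0.
- by rewrite lt_neqAle eq_sym tn0.
- split.
  + move=> s _; apply: derivableM; [exact: exprn_derivable|exact: derivable_cst].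
  + exact/cvg_at_right_filter/cont.
  + exact/cvg_at_left_filter/cont.
- by move=> s _; exact: derive_exp_coeff.
Qed.

Lemma primitive_exp_coeff n (T : R) (v : 'cV[R]_n) k :
  primitive T 0 (fun t => exp_coeff t k.+1 *: v) (fun t => exp_coeff t k *: v).
Proof.
move=> t /andP[t0 _] i; have [int_k <-] := integral_exp_coeff k t0.
have E : (fun s => (exp_coeff s k *: v) i 0) = (fun s => v i 0 * exp_coeff s k).
  by apply/funext => s; rewrite mxE mulrC.
have int_kv := @integrableZl _ _ _ mu _ (measurable_itv _) (v i 0) _ int_k.
split; first by rewrite E.
by rewrite E RintegralZl// !mxE add0r mulrC.
Qed.

(** Picard iteration run backwards: each Taylor remainder of [x] is the integral of [M] times the
    previous one, because integrating the next monomial [exp_coeff t k] yields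
    [exp_coeff t k.+1]. *)
Lemma primitive_taylor_remainder n (T : R) (M : 'M[R]_n) (x0 : 'cV[R]_n)
    (x : R -> 'cV[R]_n) : primitive T x0 x (fun s => M *m x s) -> forall k,
  primitive T 0
    (fun t => x t - \sum_(l < k.+1) exp_coeff t l *: (M ^+ l *m x0))
    (fun t => M *m (x t - \sum_(l < k) exp_coeff t l *: (M ^+ l *m x0))).
Proof.
move=> xM; elim=> [|k IH].
  have := primitiveB xM (@primitive_cst _ T x0); rewrite subrr.
  apply: eq_primitive => t; last by rewrite big_ord0 !subr0.
  by rewrite big_ord1 /exp_coeff/= !expr0 divr1 scale1r mul1mx.
have := primitiveB IH (@primitive_exp_coeff _ T (M ^+ k.+1 *m x0) k).
rewrite subr0; apply: eq_primitive => t.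
  by rewrite [in RHS]big_ord_recr/= opprD addrA.
rewrite [in RHS]big_ord_recr/= opprD addrA [in RHS]mulmxDr mulmxN -scalemxAr.
by rewrite mulmxA exprS.
Qed.

(** The bound is the initial value plus the integral of [|g|] over all of [[0, T]], summed over the
    components so that one [D] serves every index. It starts the induction on Taylor remainders. *)
Lemma primitive_bounded n (T : R) (x0 : 'cV[R]_n) f g : primitive T x0 f g ->
  exists D : R, 0 <= D /\ forall t, 0 <= t <= T -> forall i, `|f t i 0| <= D.
Proof.
move=> fg; exists (\sum_(i < n) (`|x0 i 0| + \int[mu]_(s in `[0, T]) `|g s i 0|)).
have ge0 i : 0 <= `|x0 i 0| + \int[mu]_(s in `[0, T]) `|g s i 0|.
  by rewrite addr_ge0// Rintegral_ge0.
split=> [|t tT i]; first by apply: sumr_ge0.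
have /andP[t0 t1] := tT.
rewrite (bigD1 i)//=; apply: (@le_trans _ _
  (`|x0 i 0| + \int[mu]_(s in `[0, T]) `|g s i 0|)).
  have [ig ->] := fg t tT i.
  have [iT _] := fg T (introT andP (conj (le_trans t0 t1) (lexx T))) i.
  rewrite (le_trans (ler_normD _ _))// lerD2l.
  rewrite (le_trans (le_normr_Rintegral _ ig))//.
  have iTn := integrable_norm iT.
  rewrite /Rintegral fine_le//.
  - by apply: integrable_fin_num => //; exact: integrable_norm ig.
  - exact: integrable_fin_num.
  - apply: ge0_subset_integral => //.
    + by case/integrableP : iTn.
    + by move=> s /= /itvP st; rewrite /= in_itv/= st (le_trans _ t1)// st.
by rewrite lerDl sumr_ge0.
Qed.

Lemma mulmx_entry_bound m n p (M : 'M[R]_(m, n)) (A : 'M[R]_(n, p)) (D c : R) :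
  (forall i j, `|M i j| <= c) -> (forall i j, `|A i j| <= D) ->
  forall i j, `|(M *m A) i j| <= n%:R * c * D.
Proof.
move=> Mc AD i j; rewrite mxE (le_trans (ler_norm_sum _ _ _))//.
rewrite -mulrA mulr_natl -[X in _ *+ X]card_ord -sumr_const ler_sum// => k _.
by rewrite normrM ler_pM.
Qed.

Lemma mx_entry_bounded m n (M : 'M[R]_(m, n)) :
  exists c : R, 0 <= c /\ forall i j, `|M i j| <= c.
Proof.
exists (\sum_i \sum_j `|M i j|); split=> [|i j].
  by rewrite sumr_ge0// => i _; rewrite sumr_ge0.
rewrite (bigD1 i)//= (bigD1 j)//= -addrA lerDl addr_ge0 ?sumr_ge0// => k _.
by rewrite sumr_ge0.
Qed.

(** Iterating the remainder identity gains a factor [n c t / k] at step [k], so the remainder is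
    dominated by a term of a convergent exponential series and vanishes. This gives uniqueness and
    the explicit solution at once. *)
Lemma linear_ode_taylor n (T : R) (M : 'M[R]_n) (x0 : 'cV[R]_n)
    (x : R -> 'cV[R]_n) : primitive T x0 x (fun s => M *m x s) ->
  forall t, 0 <= t <= T -> forall i : 'I_n,
  ((\sum_(l < k) exp_coeff t l *: (M ^+ l *m x0)) i 0 @[k --> \oo] --> x t i 0)%classic.
Proof.
move=> xM.
have [c [c0 Mc]] := mx_entry_bounded M.
have [D [D0 xD]] := primitive_bounded xM.
(* Here [c] bounds the entries of [M] and [D] bounds [x] on [[0, T]]. The case [k = 0] is the bound
   on [x] itself; each further case integrates the previous one. *)
have bound k t : 0 <= t <= T -> forall i, `|(x t - \sum_(l < k)
    exp_coeff t l *: (M ^+ l *m x0)) i 0| <= D * exp_coeff (n%:R * c * t) k.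
  elim: k t => [|k IH] t tT i.
    by rewrite big_ord0 subr0 /exp_coeff/= expr0 divr1 mulr1 xD.
  have /andP[t0 t1] := tT.
  have [ig ->] := primitive_taylor_remainder xM k tT i.
  rewrite mxE add0r (le_trans (le_normr_Rintegral _ ig))//.
  have [ie Ie] := integral_exp_coeff k t0.
  have ieD : mu.-integrable `[0, t]
     (EFin \o (fun s => (n%:R * c)^+ k.+1 * D * exp_coeff s k)).
    by have := @integrableZl _ _ _ mu _ (measurable_itv _) ((n%:R * c)^+ k.+1 * D) _ ie.
  apply: (@le_trans _ _ (\int[mu]_(s in `[0, t])
    ((n%:R * c)^+ k.+1 * D * exp_coeff s k))).
    apply: le_Rintegral => //.
      exact: integrable_norm ig.
    move=> s /=; rewrite in_itv/= => /andP[s0 s1].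
    have sT : 0 <= s <= T by rewrite s0 (le_trans s1).
    apply: (@le_trans _ _ (n%:R * c * (D * exp_coeff (n%:R * c * s) k))).
      by apply: mulmx_entry_bound => // i' j; rewrite ord1 IH.
    rewrite /exp_coeff/= exprMn exprS.
    by rewrite le_eqVlt; apply/orP; left; apply/eqP; ring.
  rewrite RintegralZl// Ie /exp_coeff/= [(_ * t) ^+ _]exprMn.
  by rewrite le_eqVlt; apply/orP; left; apply/eqP; ring.
move=> t tT i; have /andP[t0 t1] := tT.
apply/cvgrPdist_le => e e0.
have : (D * exp_coeff (n%:R * c * t) k @[k --> \oo] --> D * 0)%classic.
  by apply: cvgMl_tmp; exact: cvg_exp_coeff.
rewrite mulr0 => /cvgrPdist_le /(_ e e0); apply: filterS => k.
rewrite sub0r normrN => ke.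
have := bound k t tT i; rewrite mxE mxE => /le_trans; apply.
exact: le_trans (ler_norm _) ke.
Qed.

(** [mexp] is a limit in the space of matrices, whereas the solution formula is compared entry by
    entry. Every entry series is dominated by a scalar exponential series, and the entrywise limits
    assemble into the matrix limit. *)
Lemma mexp_cvg n (M : 'M[R]_n) (t : R) : (forall i j : 'I_n,
  (\sum_(l < k) exp_coeff t l *: M ^+ l) i j @[k --> \oo] --> mexp M t i j)%classic.
Proof.
have [c [c0 Mc]] := mx_entry_bounded M.
have powM k i j : `|(M ^+ k) i j| <= (n%:R * c + 1) ^+ k.
  elim: k i j => [|k IH] i j.
    by rewrite !expr0 mxE; case: (_ == _); rewrite ?normr1 ?normr0.
  rewrite exprS (le_trans (mulmx_entry_bound Mc IH _ _))// exprS.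
  by rewrite ler_wpM2r ?lerDl// exprn_ge0// addr_ge0// mulr_ge0.
pose a i j := fun l => (exp_coeff t l *: M ^+ l) i j.
have cvga i j : cvgn (series (a i j)).
  apply: normed_cvg; apply: (@series_le_cvg _ _ (exp_coeff (`|t| * (n%:R * c + 1)))).
  - by move=> l; exact: normr_ge0.
  - by move=> l; rewrite exp_coeff_ge0// mulr_ge0// addr_ge0// mulr_ge0.
  - move=> l; rewrite /a /= mxE /exp_coeff/= !normrM normfV normrX normr_nat.
    by rewrite exprMn mulrAC ler_wpM2r// ?invr_ge0// ler_wpM2l// exprn_ge0.
  - exact: is_cvg_series_exp_coeff.
pose L := \matrix_(i, j) limn (series (a i j)).
have serE k i j : series (fun l : nat => exp_coeff t l *: M ^+ l) k i j =
    series (a i j) k.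
  by rewrite /series/= summxE.
(* There are finitely many entries, so their individual convergences hold simultaneously from some
   index on. *)
have cvgL : (series (fun l : nat => exp_coeff t l *: M ^+ l) @ \oo --> L)%classic.
  apply/cvg_ballP => e e0; near=> k; split=> // i j.
  rewrite serE mxE; move: i j; near: k.
  apply: filter_forall => i; apply: filter_forall => j.
  by have /cvg_ballP := cvga i j; exact.
have -> : mexp M t = L by apply: cvg_lim => //; exact: norm_hausdorff.
move=> i j.
rewrite (_ : (fun k => _) = series (a i j)) ?mxE; first exact: cvga.
by apply/funext => k; rewrite -serE /series/= big_mkord.
Unshelve. all: by end_near. Qed.

Lemma linear_ode_mexp n (T : R) (M : 'M[R]_n) (x0 : 'cV[R]_n)
    (x : R -> 'cV[R]_n) : primitive T x0 x (fun s => M *m x s) ->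
  forall t, 0 <= t <= T -> x t = mexp M t *m x0.
Proof.
move=> xM t tT; apply/colP => i.
have := linear_ode_taylor xM tT (i := i); set u := (fun k => _) => cvg_x.
have : (u k @[k --> \oo] --> (mexp M t *m x0) i 0)%classic.
  rewrite mxE (_ : u = fun k =>
    \sum_j (\sum_(l < k) exp_coeff t l *: M ^+ l) i j * x0 j 0).
    apply: cvg_big => [|j _]; first exact: add_continuous.
    by apply: cvgMr_tmp; exact: mexp_cvg.
  apply/funext => k; rewrite /u.
  rewrite (eq_bigr (fun l : 'I_k => (exp_coeff t l *: M ^+ l) *m x0)); last first.
    by move=> l _; rewrite scalemxAl.
  by rewrite -mulmx_suml mxE.
by move/cvg_lim => <-//; move/cvg_lim : cvg_x => <-.
Qed.

(** The Taylor expansion for [M = b%:M], whose powers are scalar matrices, collapses to the series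
    of [expR]. *)
Lemma scalar_ode_expR n (T b : R) (x0 : 'cV[R]_n) (x : R -> 'cV[R]_n) :
  primitive T x0 x (fun s => b *: x s) ->
  forall t, 0 <= t <= T -> x t = expR (b * t) *: x0.
Proof.
move=> xb t tT; apply/colP => i; rewrite mxE.
have xM : primitive T x0 x (fun s => b%:M *m x s).
  by apply: eq_primitive xb => s//; rewrite mul_scalar_mx.
have := linear_ode_taylor xM tT (i := i); set u := (fun k => _) => cvg_x.
have : (u k @[k --> \oo] --> expR (b * t) * x0 i 0)%classic.
  rewrite (_ : u = fun k => series (exp_coeff (b * t)) k * x0 i 0).
    by apply: cvgMr_tmp; exact: is_cvg_series_exp_coeff.
  apply/funext => k; rewrite /u summxE /series/= big_mkord mulr_suml.
  apply: eq_bigr => l _; rewrite -rmorphXn /= mul_scalar_mx !mxE /exp_coeff/= exprMn.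
  by ring.
by move/cvg_lim => <-//; move/cvg_lim : cvg_x => <-.
Qed.

End LinearODE.

(** * The filtered data equation *)

Section HankelMatrix.
Context {R : realType} (n : nat).
Implicit Types (a b c : nat -> R).

(* H_ij = c_(n-1-i-j) with c_0 = 1: the symmetric intertwiner H A = A^T H of
   the companion matrix A. *)
Definition hankel c : 'M[R]_n := \matrix_(i < n, j < n)
  if (i + j < n)%N then
    (if (i + j == n.-1)%N then 1 else c (n.-1 - (i + j))%N) else 0.

Definition unitcol k : 'cV[R]_n := \col_(i < n) ((i : nat) == k)%:R.

Lemma plantA_trmx a : plantA n a = (companion n a)^T.
Proof. by apply/matrixP => i j; rewrite !mxE. Qed.

Lemma plantC_trmx : plantC R n = (Br R n)^T.
Proof. by apply/matrixP => i j; rewrite !mxE. Qed.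

Lemma hankel_sym c : (hankel c)^T = hankel c.
Proof. by apply/matrixP => i j; rewrite !mxE addnC. Qed.

End HankelMatrix.

(** * Intertwining a companion matrix with its transpose *)

Section CompanionIntertwiner.
Context {R : realType} (m : nat).
Local Notation n := m.+1.
Implicit Types (a b c : nat -> R).

Lemma hankel_companion c :
  hankel n c *m companion n c = (companion n c)^T *m hankel n c.
Proof.
suff sym : (hankel n c *m companion n c)^T = hankel n c *m companion n c.
  by rewrite -sym trmx_mul hankel_sym.
(* The visibly symmetric entries of [H A]: the corner [- c n], zeros in the rest of the first row
   and column, and a shifted Hankel block elsewhere. In the first row the zeros come from the
   cancellation of [c (m - j)] against the last row of [A]. *)
pose F (i j : nat) : R := if i == 0%N then (if j == 0%N then - c n else 0)
  else if j == 0%N then 0 else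
  if (i + j <= n)%N then (if (i + j == n)%N then 1 else c (n - (i + j))%N) else 0.
have FE (i j : 'I_n) : (hankel n c *m companion n c) i j = F i j.
  rewrite mxE big_ord_recr/= !mxE /= ltnn.
  case: j => -[|j] jn /=.
    rewrite big1 ?add0r; last first.
      by move=> k _; rewrite !mxE /= (ltn_ord k : k.+1 < n)%N mulr0.
    rewrite /F subn0; case: (i : nat) => [|i']/=.
      by rewrite add0n ltnSn eqxx mul1r.
    by rewrite addSn ltnS ltnNge leq_addl mul0r.
  rewrite (bigD1 (Ordinal (jn : (j < m)%N)))//= big1 ?addr0; last first.
    move=> k kj; rewrite !mxE /= (ltn_ord k : k.+1 < n)%N eqSS.
    move: kj; rewrite -val_eqE/= eq_sym => /negPf ->.
    by rewrite mulr0.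
  rewrite !mxE/= (jn : j.+1 < n)%N eqxx mulr1 /F.
  have jm : (j < m)%N := jn.
  case: (i : nat) => [|i']/=.
    rewrite !add0n ltnSn eqxx mul1r ltnS (ltnW jm) (ltn_eqF jm) subSS.
    by rewrite subrr.
  have -> : (i'.+1 + m < n)%N = false by rewrite addSn ltnS ltnNge leq_addl.
  rewrite mul0r addr0.
  by rewrite addSn addnS !ltnS eqSS !subSS.
by apply/matrixP => i j; rewrite mxE !FE /F addnC; case: eqP => // _; case: eqP.
Qed.

Lemma hankel_Br c : hankel n c *m Br R n = unitcol n 0.
Proof.
apply/colP => i; rewrite mxE (bigD1 ord_max)//= big1 ?addr0; last first.
  by move=> k km; rewrite !mxE /= -[m]/(val (@ord_max m)) val_eqE (negPf km) mulr0.
rewrite !mxE/= eqxx mulr1; case: (i : nat) => [|i']/=;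
  first by rewrite add0n ltnSn eqxx.
by rewrite addSn ltnS ltnNge leq_addl.
Qed.

(** [A^T] moves each basis vector to the next one until its last column is reached, so the first [n]
    Krylov vectors of [e_0] form the standard basis. *)
Lemma companion_trmx_unitcol c k : (k < n)%N ->
  (companion n c)^T ^+ k *m unitcol n 0 = unitcol n k.
Proof.
elim: k => [|k IH] kn; first by rewrite expr0 mul1mx.
rewrite exprS -mulmxE -mulmxA IH 1?ltnW//; apply/colP => i.
rewrite mxE (bigD1 (Ordinal (ltnW kn)))//= big1 ?addr0.
  by rewrite !mxE/= kn eqxx mulr1.
by move=> j jk; rewrite !mxE -[k]/(val (Ordinal (ltnW kn))) val_eqE (negPf jk) mulr0.
Qed.

Lemma sum_unitcol (v : 'cV[R]_n) : \sum_(k < n) v k 0 *: unitcol n k = v.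
Proof.
apply/colP => i; rewrite summxE (bigD1 i)//= big1 ?addr0;
  first by rewrite !mxE eqxx mulr1.
by move=> k ki; rewrite !mxE val_eqE eq_sym (negPf ki) mulr0.
Qed.

(* Since (A, Br) is controllable, an intertwiner P A = A^T P is determined by
   P Br = v; the symmetry of the Hankel matrix then forces C P = v^T, which is
   the time-domain form of C (s - A^T)^-1 v = v^T (s - A)^-1 Br. *)
Lemma companion_intertwiner c (v : 'cV[R]_n) : exists P : 'M[R]_n,
  [/\ P *m companion n c = (companion n c)^T *m P, P *m Br R n = v &
      plantC R n *m P = v^T].
Proof.
set A := companion n c; set H := hankel n c.
have AH k : A^T ^+ k *m H = H *m A ^+ k.
  elim: k => [|k IH]; first by rewrite !expr0 mul1mx mulmx1.
  by rewrite exprSr -mulmxE -mulmxA -hankel_companion mulmxA IH -mulmxA exprSr.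
have AkT k : (A^T ^+ k)^T = A ^+ k.
  elim: k => [|k IH]; first by rewrite !expr0 trmx1.
  by rewrite exprS -mulmxE trmx_mul trmxK IH exprSr.
(* The witness is [p(A^T) H], where [p] has coefficients [v k 0]. A polynomial in [A^T] preserves
   the intertwining relation, and [H Br = e_0] is sent by [p(A^T)] to [v]. *)
exists (\sum_(k < n) v k 0 *: (A^T ^+ k *m H)); split.
- rewrite mulmx_suml mulmx_sumr; apply: eq_bigr => k _.
  rewrite -scalemxAl -scalemxAr; congr (_ *: _).
  by rewrite -mulmxA hankel_companion !mulmxA !mulmxE -exprSr exprS.
- rewrite mulmx_suml -[RHS]sum_unitcol; apply: eq_bigr => k _.
  by rewrite -scalemxAl -mulmxA hankel_Br companion_trmx_unitcol.
- rewrite mulmx_sumr -[in RHS](sum_unitcol v) linear_sum/=; apply: eq_bigr => k _.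
  rewrite -scalemxAr linearZ/= -(companion_trmx_unitcol c (ltn_ord k)).
  by rewrite -(hankel_Br c) -/H -/A plantC_trmx !trmx_mul AkT hankel_sym -mulmxA -AH.
Qed.

End CompanionIntertwiner.

(** * The filtered relation between [delta], [phi] and [ups] *)

Section FilterIdentity.
Context {R : realType} (m : nat).
Local Notation n := m.+1.
Variables (a b c : nat -> R) (beta T : R) (x0 : 'cV[R]_n) (u : R -> R).
Variables (x zeta mu : R -> 'cV[R]_n) (phi : R -> 'cV[R]_(n + n)) (ups : R -> 'cV[R]_1).

Let A : 'M[R]_n := companion n c.
Let kappa : 'cV[R]_n := \col_i (c (n - i)%N - a (n - i)%N).

(** Two companion matrices differ only in their last row, and [kappa] lists that difference;
    transposed, this writes the plant as [A^T] plus an injection of the output along [kappa]. *)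
Lemma companion_feedback : companion n a = A + Br R n *m kappa^T.
Proof.
apply/matrixP => i j; rewrite !mxE big_ord1 !mxE.
have [im|mi] := ltnP i.+1 n; first by rewrite (ltn_eqF (im : (i < m)%N)) mul0r addr0.
have -> : (i : nat) = m by apply/eqP; rewrite eqn_leq -ltnS ltn_ord -ltnS mi.
by rewrite eqxx mul1r addrA addNr add0r.
Qed.

Lemma Lb_outer : Lb n b = Br R n *m (plantB n b)^T.
Proof.
apply/matrixP => i j; rewrite !mxE big_ord1 !mxE.
by case: ifP => _; rewrite ?mul1r ?mul0r.
Qed.

Lemma Gf_outer : Gf R n = col_mx 0 (Br R n *m plantC R n).
Proof.
apply/matrixP => i j; rewrite !mxE.
case: (splitP i) => k ik; rewrite ik !mxE ?big_ord1 ?mxE.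
  by rewrite ltn_eqF// (leq_trans (ltn_ord k))//= leq_addl.
by rewrite (_ : (n + n).-1 = n + m)%N ?addnS// eqn_add2l/= -natrM mulnb.
Qed.

Hypothesis ode_x : ode_sol (plantA n a) (plantB n b) (fun s => (u s)%:M) x0 T x.
Hypothesis ode_zeta : ode_sol A (Br R n) (fun s => (u s)%:M) 0 T zeta.
Hypothesis ode_mu : ode_sol A (Br R n) (fun s => plantC R n *m x s) 0 T mu.
Hypothesis ode_phi :
  ode_sol (- beta%:M) 1%:M (fun s => col_mx (zeta s) (mu s)) 0 T phi.
Hypothesis ode_ups : ode_sol (- beta%:M) 1%:M (fun s => (u s)%:M) 0 T ups.
Hypothesis beta_noneig : ~~ eigenvalue A (- beta).

Lemma shifted_companion_unit : A^T + beta%:M \in unitmx.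
Proof.
rewrite -unitmx_tr linearD/= trmxK tr_scalar_mx.
move: beta_noneig; rewrite /eigenvalue /eigenspace negbK kermx_eq0 row_free_unit.
by rewrite raddfN/= opprK.
Qed.

Lemma filter_identity t : 0 <= t <= T ->
  col_mx (zeta t) (mu t) - beta *: phi t =
  Af n a b c *m phi t + Bf R n *m ups t +
  Gf R n *m invmx (A^T + beta%:M) *m
    (mexp A^T t *m x0 - expR (- (beta * t)) *: x0).
Proof.
move=> tT.
have [P [PA PB PC]] := companion_intertwiner c kappa.
have [Q [QA QB QC]] := companion_intertwiner c (plantB n b).
pose e s := x s - P *m mu s - Q *m zeta s.
(* Both inputs cancel: [P Br = kappa] absorbs the output injection and [Q Br = plantB n b] absorbs
   [u], while the intertwining relations turn [P A] and [Q A] into [A^T P] and [A^T Q]. *)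
have e_ode : primitive T x0 e (fun s => A^T *m e s).
  have := primitiveB (primitiveB ode_x (primitiveM P ode_mu)) (primitiveM Q ode_zeta).
  rewrite !mulmx0 !subr0; apply: eq_primitive => s //.
  rewrite plantA_trmx companion_feedback linearD/= trmx_mul trmxK -plantC_trmx.
  rewrite !mulmxDr !mulmxN !mulmxA PA PB QA QB mulmxDl -/A.
  by apply/colP => i; rewrite !mxE; ring.
(* The output is thereby expressed through [mu], [zeta] and [e]; substituting it in the equation of
   [mu] produces the lower block row of [Af] and the forcing term [Gf e]. *)
have Ce s : plantC R n *m e s =
    plantC R n *m x s - kappa^T *m mu s - (plantB n b)^T *m zeta s.
  by rewrite !mulmxBr !mulmxA PC QC.
set Gamma := Gf R n *m invmx _.
have GammaA : Gamma *m A^T = Gf R n - beta *: Gamma.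
  rewrite -mul_mx_scalar -[in RHS](mulmxKV shifted_companion_unit (Gf R n)).
  by rewrite -/Gamma mulmxDr addrK.
pose chi s := col_mx (zeta s) (mu s).
pose chi' s := Af n a b c *m chi s + Bf R n *m (u s)%:M + Gf R n *m e s.
have chi_ode : primitive T 0 chi chi'.
  have := primitive_col_mx ode_zeta ode_mu; rewrite col_mx0.
  apply: eq_primitive => s //.
  rewrite /chi' /chi /Af /Bf Gf_outer !mul_block_col !mul_col_mx !add_col_mx.
  rewrite !mul0mx !addr0; congr col_mx.
  rewrite -mulmxA Ce Lb_outer companion_feedback mulmxDl -!mulmxA !mulmxBr -/A.
  by apply/colP => i; rewrite !mxE; ring.
(* [q] is the defect of the desired identity, with [Gamma e] in place of [eps]. By [GammaA] the
   terms in [e] combine so that [q' = - beta q]; its initial value [- Gamma x0] supplies the scalar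
   exponential in [eps]. *)
pose q s := chi s - beta *: phi s - Af n a b c *m phi s - Bf R n *m ups s
   - Gamma *m e s.
have q_ode : primitive T (- (Gamma *m x0)) q (fun s => - beta *: q s).
  have := primitiveB (primitiveB (primitiveB (primitiveB chi_ode
    (primitiveZ beta ode_phi)) (primitiveM (Af n a b c) ode_phi))
    (primitiveM (Bf R n) ode_ups)) (primitiveM Gamma e_ode).
  rewrite scaler0 !mulmx0 !subr0 sub0r; apply: eq_primitive => s //.
  rewrite /chi' /q.
  rewrite !mulNmx !mul1mx !mul_scalar_mx mulmxA GammaA mulmxBl -/(chi s).
  rewrite !mulmxDr !mulmxN -!scalemxAr -!scalemxAl.
  by apply/colP => i; rewrite !mxE; ring.
have := scalar_ode_expR q_ode tT; rewrite /q (linear_ode_mexp e_ode tT) => /eqP.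
rewrite !subr_eq => /eqP; rewrite -/(chi t) => ->.
rewrite mulNr mulmxBr -!scalemxAr.
by apply/colP => i; rewrite !mxE; ring.
Qed.

End FilterIdentity.

(** * Lyapunov's theorem *)

(** Schur's unitary triangularization. The diagonal entries are roots of the characteristic
    polynomial of the triangular form, and [P] transports its eigenvectors back to [A]. *)
Lemma trigonalization (F : numClosedFieldType) k (A : 'M[F]_k) : (0 < k)%N ->
  exists P T : 'M[F]_k, [/\ P \in unitmx, P *m A = T *m P, is_trig_mx T &
    forall i, eigenvalue A (T i i)].
Proof.
move=> k0; have [P Punitary Ttrig] := Schur A k0.
have Punit := unitarymx_unit Punitary.
exists P, (conjmx P A).
have PA : P *m A = conjmx P A *m P by rewrite conjumx// mulmxKV.
split=> // i; apply/eigenvalueP.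
have : eigenvalue (conjmx P A) (conjmx P A i i).
  rewrite eigenvalue_root_char char_poly_trig// rootE horner_prod.
  by apply/prodf_eq0; exists i => //; rewrite hornerXsubC subrr.
move=> /eigenvalueP[v vT v0]; exists (v *m P).
  by rewrite -mulmxA PA mulmxA vT scalemxAl.
by apply: contraNneq v0 => vP0; rewrite -(mulmxK Punit v) vP0 mul0mx.
Qed.

Lemma scaled_similarity (F : comUnitRingType) k (A P T : 'M[F]_k) (d d' : 'I_k -> F) :
  P \in unitmx -> P *m A = T *m P -> (forall i, d i * d' i = 1) ->
  exists2 Y : 'M[F]_k, Y \in unitmx &
    A *m Y = Y *m (\matrix_(i, j) (d' i * T i j * d j)).
Proof.
move=> Punit PA dd'; pose D := diag_mx (\row_i d i); pose D' := diag_mx (\row_i d' i).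
have DD' : D *m D' = 1%:M.
  by apply/matrixP => i j; rewrite mulmx_diag !mxE dd'.
have [Dunit _] := mulmx1_unit DD'.
exists (invmx P *m D); first by rewrite unitmx_mul unitmx_inv Punit.
have -> : \matrix_(i, j) (d' i * T i j * d j) = D' *m T *m D.
  by apply/matrixP => i j; rewrite mul_mx_diag mul_diag_mx !mxE.
rewrite !mulmxA -[_ *m D *m D']mulmxA DD' mulmx1; congr (_ *m _).
by apply: (can_inj (mulKmx Punit)); rewrite mulmxA PA mulmxK// mulKVmx.
Qed.

Section RealParts.
Context {R : realType}.
Local Notation C := R[i].
Local Notation Re := (@complex.Re R).
Local Notation Im := (@complex.Im R).
Local Notation normc := (@Normc.normc R).
Local Notation toC := (map_mx (fun x : R => (x%:C)%C)).

Lemma ReD (x y : C) : Re (x + y) = Re x + Re y.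
Proof. by case: x y => [? ?] []. Qed.
Lemma ImD (x y : C) : Im (x + y) = Im x + Im y.
Proof. by case: x y => [? ?] []. Qed.
Lemma Re_sum (I : finType) (F : I -> C) : Re (\sum_i F i) = \sum_i Re (F i).
Proof. by apply: (big_morph Re ReD). Qed.
Lemma Im_sum (I : finType) (F : I -> C) : Im (\sum_i F i) = \sum_i Im (F i).
Proof. by apply: (big_morph Im ImD). Qed.

Lemma map_Re_mulmx_real m n p (X : 'M[C]_(m, n)) (A : 'M[R]_(n, p)) :
  map_mx Re (X *m toC A) = map_mx Re X *m A.
Proof.
apply/matrixP => i j; rewrite !mxE Re_sum; apply: eq_bigr => k _.
by rewrite !mxE; case: (X i k) => r s /=; rewrite mulr0 subr0.
Qed.

Lemma map_Im_mulmx_real m n p (X : 'M[C]_(m, n)) (A : 'M[R]_(n, p)) :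
  map_mx Im (X *m toC A) = map_mx Im X *m A.
Proof.
apply/matrixP => i j; rewrite !mxE Im_sum; apply: eq_bigr => k _.
by rewrite !mxE; case: (X i k) => r s /=; rewrite mulr0 add0r.
Qed.

Lemma map_Re_real_mulmx m n p (A : 'M[R]_(m, n)) (X : 'M[C]_(n, p)) :
  map_mx Re (toC A *m X) = A *m map_mx Re X.
Proof.
apply/matrixP => i j; rewrite !mxE Re_sum; apply: eq_bigr => k _.
by rewrite !mxE; case: (X k j) => r s /=; rewrite mul0r subr0.
Qed.

Lemma normc_ge0 (z : C) : 0 <= normc z.
Proof. by case: z => r s; rewrite sqrtr_ge0. Qed.

Lemma Re_le_normc (z : C) : Re z <= normc z.
Proof.
case: z => r s /=; apply: le_trans (ler_norm r) _.
by rewrite -sqrtr_sqr ler_wsqrtr// lerDl sqr_ge0.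
Qed.

Lemma normc_conjc (z : C) : normc (conjc z) = normc z.
Proof. by case: z => r s /=; rewrite sqrrN. Qed.

Lemma Re_mulc_conjc (z : C) : Re (z * conjc z) = normc z ^+ 2.
Proof.
case: z => r s /=; rewrite sqr_sqrtr ?addr_ge0 ?sqr_ge0//.
by ring.
Qed.

Lemma normc_real (x : R) : 0 <= x -> normc (x%:C)%C = x.
Proof. by move=> x0; rewrite /= expr0n/= addr0 sqrtr_sqr ger0_norm. Qed.

Lemma quad_sym k (S : 'M[R]_k) (v w : 'cV[R]_k) : S^T = S ->
  (v^T *m S *m w) 0 0 = (w^T *m S *m v) 0 0.
Proof.
move=> Ssym; have -> : (v^T *m S *m w) 0 0 = (v^T *m S *m w)^T 0 0 by rewrite [RHS]mxE.
by rewrite !trmx_mul trmxK Ssym mulmxA.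
Qed.

(** Split a left eigenvector into real and imaginary parts [p] and [q]. Evaluating the negated
    Lyapunov form at both and adding gives [- 2 Re z] times a nonnegative number, and the sum is
    positive. *)
Lemma lyapunov_hurwitz k (M S : 'M[R]_k) :
  posdef S -> negdef (M *m S + S *m M^T) -> hurwitz M.
Proof.
move=> [Ssym Spos] [_ Lneg] z /eigenvalueP[v vM v0].
pose p := (map_mx Re v)^T; pose q := (map_mx Im v)^T.
have pM : M^T *m p = Re z *: p - Im z *: q.
  rewrite -trmx_mul -map_Re_mulmx_real vM; apply/colP => i; rewrite !mxE.
  by case: (v 0 i); case: (z) => /= r s r' s'; ring.
have qM : M^T *m q = Re z *: q + Im z *: p.
  rewrite -trmx_mul -map_Im_mulmx_real vM; apply/colP => i; rewrite !mxE.
  by case: (v 0 i); case: (z) => /= r s r' s'; ring.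
have form (w : 'cV[R]_k) : (w^T *m - (M *m S + S *m M^T) *m w) 0 0 =
    - 2 * (w^T *m S *m (M^T *m w)) 0 0.
  have E : (w^T *m (M *m S) *m w) 0 0 = (w^T *m S *m (M^T *m w)) 0 0.
    by rewrite (quad_sym w (M^T *m w) Ssym) trmx_mul trmxK !mulmxA.
  rewrite mulmxN mulNmx mulmxDr mulmxDl mxE mxE E !mulmxA.
  by ring.
have nonneg (w : 'cV[R]_k) : 0 <= (w^T *m S *m w) 0 0.
  have [->|w0] := eqVneq w 0; last exact: ltW (Spos _ w0).
  by rewrite mulmx0 mxE.
have Lnonneg (w : 'cV[R]_k) : 0 <= (w^T *m - (M *m S + S *m M^T) *m w) 0 0.
  have [->|w0] := eqVneq w 0; last exact: ltW (Lneg _ w0).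
  by rewrite mulmx0 mxE.
have Lsum : 0 < (p^T *m - (M *m S + S *m M^T) *m p) 0 0 +
    (q^T *m - (M *m S + S *m M^T) *m q) 0 0.
  have [p0|/Lneg pneg] := eqVneq p 0; last exact: ltr_wpDr.
  apply: ltr_wpDl => //; apply: Lneg; apply: contraNneq v0 => q0.
  apply/eqP/rowP => i; move/colP/(_ i): p0; move/colP/(_ i): q0; rewrite !mxE.
  by case: (v 0 i) => r s /= -> ->.
have pos : 0 <= (p^T *m S *m p) 0 0 + (q^T *m S *m q) 0 0 by rewrite addr_ge0.
(* The cross terms carry [Im z] with opposite signs and cancel by symmetry of [S]. *)
have E : (p^T *m - (M *m S + S *m M^T) *m p) 0 0 +
    (q^T *m - (M *m S + S *m M^T) *m q) 0 0 =
    - (2 * Re z) * ((p^T *m S *m p) 0 0 + (q^T *m S *m q) 0 0).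
  have lin r s (A : 'rV[R]_k) (y w : 'cV[R]_k) :
      (A *m (r *: y + s *: w)) 0 0 = r * (A *m y) 0 0 + s * (A *m w) 0 0.
    by rewrite mulmxDr -!scalemxAr !mxE.
  rewrite !form pM qM -scaleNr !lin.
  rewrite (quad_sym q p Ssym); set f := (_ *m q) 0 0.
  by ring.
rewrite E in Lsum; rewrite ltNge; apply/negP => z0.
by move: Lsum; rewrite ltNge mulNr oppr_le0 mulr_ge0// mulr_ge0.
Qed.

Lemma quad_row_sum k (w : 'rV[C]_k) (T : 'M[C]_k) :
  Re ((w *m T *m map_mx conjc w^T) 0 0) =
  \sum_i \sum_j Re (w 0 i * T i j * conjc (w 0 j)).
Proof.
rewrite mxE Re_sum exchange_big/=; apply: eq_bigr => j _.
by rewrite !mxE mulr_suml Re_sum.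
Qed.

(** With [N i] the modulus of [w 0 i], each off-diagonal term is at most [eps N_i N_j], hence at
    most [eps / 2 * (N_i^2 + N_j^2)]. Over all pairs this costs [eps k] times the squared norm, less
    than the diagonal gain [mm]. *)
Lemma diag_dominant_neg k (T : 'M[C]_k) (mm eps : R) :
  0 <= eps -> eps * k%:R < mm ->
  (forall i, Re (T i i) <= - mm) ->
  (forall i j, i != j -> normc (T i j) <= eps) ->
  forall w : 'rV[C]_k, w != 0 -> Re ((w *m T *m map_mx conjc w^T) 0 0) < 0.
Proof.
move=> eps0 epsm Tdiag Toff w w0.
pose N i := normc (w 0 i).
have N0 i : 0 <= N i by exact: normc_ge0.
have term i j : Re (w 0 i * T i j * conjc (w 0 j)) <=
   (if j == i then - mm * N i ^+ 2 else 0) + eps / 2 * (N i ^+ 2 + N j ^+ 2).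
  have [->|ji] := eqVneq j i.
    rewrite -[leLHS]addr0 lerD//; last first.
      by rewrite mulr_ge0// ?divr_ge0// addr_ge0// sqr_ge0.
    have -> : Re (w 0 i * T i i * conjc (w 0 i)) = Re (T i i) * N i ^+ 2.
      rewrite -Re_mulc_conjc; case: (w 0 i) => r s; case: (T i i) => r' s' /=.
      by ring.
    by rewrite ler_wpM2r ?sqr_ge0.
  rewrite add0r (le_trans (Re_le_normc _))// !Normc.normcM normc_conjc -!/(N _).
  apply: (@le_trans _ _ (eps * (N i * N j))).
    by rewrite mulrAC mulrC ler_wpM2r ?mulr_ge0// Toff// eq_sym.
  rewrite -mulrA ler_wpM2l//.
  by have := sqr_ge0 (N i - N j); nra.
pose S := \sum_i N i ^+ 2.
have Spos : 0 < S.
  rewrite lt_neqAle sumr_ge0 ?andbT; last by move=> i _; rewrite sqr_ge0.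
  apply: contraNneq w0 => /esym/eqP.
  rewrite psumr_eq0 => [/allP S0|i _]; last exact: sqr_ge0.
  apply/eqP/rowP => i; have := S0 i (mem_index_enum _); rewrite sqrf_eq0 mxE.
  by move/eqP/Normc.eq0_normc.
rewrite quad_row_sum; apply: (@le_lt_trans _ _ (- mm * S + eps * k%:R * S)).
  apply: (@le_trans _ _ (\sum_i \sum_j ((if j == i then - mm * N i ^+ 2 else 0) +
     eps / 2 * (N i ^+ 2 + N j ^+ 2)))).
    by apply: ler_sum => i _; apply: ler_sum => j _; exact: term.
  rewrite le_eqVlt; apply/orP; left; apply/eqP.
  rewrite (eq_bigr (fun i => - mm * N i ^+ 2 +
    (eps / 2 * (k%:R * N i ^+ 2) + eps / 2 * S))).
    rewrite !big_split/= -!mulr_sumr -/S sumr_const card_ord -mulr_natr.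
    by field.
  move=> i _; rewrite big_split/= -big_mkcond big_pred1_eq -mulr_sumr big_split/=.
  by rewrite sumr_const card_ord -[_ *+ k]mulr_natl mulrDr.
by rewrite -mulrDl pmulr_llt0// addrC subr_lt0.
Qed.

(** Diagonal scaling keeps the diagonal and shrinks each entry strictly below it by at least
    [1 / rho]; a large [rho] makes the negative diagonal dominate. *)
Lemma trig_scaling k (T : 'M[C]_k) : is_trig_mx T -> (forall i, Re (T i i) < 0) ->
  exists rho : R, 0 < rho /\ forall w : 'rV[C]_k, w != 0 ->
    Re ((w *m (\matrix_(i, j) (T i j * ((rho ^+ j / rho ^+ i)%:C)%C)) *m
      map_mx conjc w^T) 0 0) < 0.
Proof.
move=> /is_trig_mxP Ttrig Tdiag.
pose mm : R := \big[Num.min/1]_i - Re (T i i).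
have mm0 : 0 < mm.
  rewrite /mm; elim/big_ind: _ => // [y z y0 z0|i _]; first by rewrite lt_min y0.
  by rewrite oppr_gt0.
have Tmm i : Re (T i i) <= - mm by rewrite lerNr; exact: bigmin_le.
pose K := \sum_i \sum_j normc (T i j).
have K0 : 0 <= K by do 2!(apply: sumr_ge0 => ? _); exact: normc_ge0.
have TK i j : normc (T i j) <= K.
  rewrite /K (bigD1 i)//= (bigD1 j)//= -addrA lerDl addr_ge0//.
    by apply: sumr_ge0 => ? _; exact: normc_ge0.
  by do 2!(apply: sumr_ge0 => ? _); exact: normc_ge0.
(* The denominator [k.+1] makes [eps * k < mm] strict. With [K] bounding all moduli,
   [rho = 1 + K / eps] ensures both [1 <= rho] and [K / rho <= eps]. *)
pose eps := mm / k.+1%:R.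
have eps0 : 0 < eps by rewrite divr_gt0.
pose rho := 1 + K / eps.
have rho1 : 1 <= rho by rewrite lerDl divr_ge0// ltW.
have rho0 : 0 < rho by exact: lt_le_trans rho1.
exists rho; split => //.
apply: (@diag_dominant_neg _ _ mm eps); first exact: ltW.
- by rewrite /eps mulrAC ltr_pdivrMr// ltr_pM2l// ltr_nat.
- by move=> i; rewrite mxE divff ?mulr1// expf_neq0// gt_eqF.
- move=> i j ij; rewrite mxE.
  case: (ltngtP i j) => [lt_ij|lt_ji|/val_inj/eqP]; last by rewrite (negPf ij).
    by rewrite Ttrig// mul0r Normc.normc0 ltW.
  have coef0 : 0 <= rho ^+ j / rho ^+ i by rewrite divr_ge0 ?exprn_ge0 ?ltW.
  rewrite Normc.normcM normc_real//.
  apply: (@le_trans _ _ (K * rho^-1)).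
    rewrite ler_pM ?normc_ge0//.
    rewrite ler_pdivrMr ?exprn_gt0// ler_pdivlMl// -exprS.
    by rewrite ler_weXn2l.
  rewrite ler_pdivrMr// /rho mulrDr mulr1 mulrCA divff ?mulr1 ?gt_eqF//.
  by rewrite lerDr ltW.
Qed.

Lemma hurwitz_sum_of_squares k (M : 'M[R]_k) : (0 < k)%N -> hurwitz M ->
  exists (Y T : 'M[C]_k), [/\ Y \in unitmx, toC M *m Y = Y *m T &
    forall w : 'rV[C]_k, w != 0 -> Re ((w *m T *m map_mx conjc w^T) 0 0) < 0].
Proof.
move=> k0 Mhur.
have [P [T [Punit PMT Ttrig Teig]]] := trigonalization (toC M) k0.
have Tdiag i : Re (T i i) < 0 by apply: Mhur; exact: Teig.
have [rho [rho0 Tneg]] := trig_scaling Ttrig Tdiag.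
have rhoV i : ((rho ^+ i)%:C)%C * ((rho ^- i)%:C)%C = 1 :> C.
  by rewrite -rmorphM/= divff// expf_neq0// gt_eqF.
have [Y Yunit MY] := scaled_similarity Punit PMT (fun i : 'I_k => rhoV i).
exists Y; eexists; split; [exact: Yunit|exact: MY|] => w w0.
have := Tneg w w0; congr (Re ((_ *m _ *m _) 0 0) < 0).
by apply/matrixP => i j; rewrite !mxE rmorphM/= mulrA mulrC mulrA.
Qed.

(** The certificate is the real part of [Y] times its conjugate transpose. For real [v], put
    [w = v^T Y]: the form of [S] is the sum of the squared moduli of [w], and that of [M S] is the
    real part of the Hermitian-type form of [T] at [w], which is negative. *)
Lemma hurwitz_lyapunov k (M : 'M[R]_k) : hurwitz M ->
  exists S : 'M[R]_k, posdef S /\ negdef (M *m S + S *m M^T).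
Proof.
(* In dimension zero there is no nonzero vector, so [S = 0] works; the triangularization is for
   positive size. *)
case: k M => [|k] M Mhur.
  exists 0; split; split; try by apply/matrixP => -[].
    by move=> v /negP[]; apply/eqP/colP => -[].
  by move=> v /negP[]; apply/eqP/colP => -[].
have [Y [T [Yunit MY Tneg]]] := hurwitz_sum_of_squares (ltn0Sn k) Mhur.
pose S := map_mx Re (Y *m map_mx conjc Y^T).
have Ssym : S^T = S.
  apply/matrixP => i j; rewrite !mxE !Re_sum; apply: eq_bigr => l _; rewrite !mxE.
  by case: (Y i l) (Y j l) => r s [r' s'] /=; ring.
pose w (v : 'cV[R]_k.+1) := toC v^T *m Y.
have wC v : map_mx conjc (w v)^T = map_mx conjc Y^T *m toC v.
  rewrite /w trmx_mul map_mxM; congr (_ *m _).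
  by apply/matrixP => i j; rewrite !mxE/= oppr0.
have w0 v : v != 0 -> w v != 0.
  apply: contraNneq => wv0; have := mulmxK Yunit (toC v^T); rewrite -/(w v) wv0 mul0mx.
  move=> /esym v0; apply/eqP/colP => i; have /rowP/(_ i) := v0; rewrite !mxE.
  by case.
have S_form v : (v^T *m S *m v) 0 0 = Re ((w v *m map_mx conjc (w v)^T) 0 0).
  rewrite wC /S -map_Re_real_mulmx -map_Re_mulmx_real [LHS]mxE.
  by rewrite /w !mulmxA.
have MS_form v : (v^T *m (M *m S) *m v) 0 0 =
    Re ((w v *m T *m map_mx conjc (w v)^T) 0 0).
  rewrite wC /S -!map_Re_real_mulmx -map_Re_mulmx_real [LHS]mxE.
  by rewrite /w !mulmxA -[_ *m toC M *m Y]mulmxA MY !mulmxA.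
exists S; split; split => //.
- move=> v /w0 v0; rewrite S_form mxE Re_sum.
  have term i : w v 0 i * map_mx conjc (w v)^T i 0 = w v 0 i * conjc (w v 0 i).
    by rewrite !mxE.
  under eq_bigr do rewrite term Re_mulc_conjc.
  rewrite lt_neqAle sumr_ge0 ?andbT; last by move=> i _; rewrite sqr_ge0.
  apply: contraNneq v0 => /esym/eqP.
  rewrite psumr_eq0 => [/allP S0|i _]; last exact: sqr_ge0.
  apply/eqP/rowP => i; have := S0 i (mem_index_enum _); rewrite sqrf_eq0 [RHS]mxE.
  by move/eqP/Normc.eq0_normc.
- by rewrite linearN/= linearD/= !trmx_mul trmxK Ssym addrC.
- move=> v /w0/Tneg; rewrite -MS_form => MS_neg.
  rewrite mulmxN mulNmx mulmxDr mulmxDl mxE mxE.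
  have -> : (v^T *m (S *m M^T) *m v) 0 0 = (v^T *m (M *m S) *m v) 0 0.
    have -> : (v^T *m (M *m S) *m v) 0 0 = (v^T *m (M *m S) *m v)^T 0 0.
      by rewrite [RHS]mxE.
    by rewrite !trmx_mul trmxK Ssym !mulmxA.
  by rewrite oppr_gt0 -mulr2n pmulrn_llt0.
Qed.

End RealParts.

(** * Stabilizing gains parametrized by data *)

Section DataDrivenLyapunov.
Context {R : realType}.

Lemma posdef_unitmx k (S : 'M[R]_k) : posdef S -> S \in unitmx.
Proof.
move=> [_ Spos]; rewrite -row_free_unit -kermx_eq0; apply/rowV0P => v /sub_kermxP vS.
apply/eqP; apply: contraT => v0.
have /Spos : v^T != 0 by rewrite -trmx0 (inj_eq trmx_inj).
by rewrite trmxK vS mul0mx mxE ltxx.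
Qed.

Lemma posdefDD k (S : 'M[R]_k) : S^T = S -> posdef (S + S) <-> posdef S.
Proof.
move=> Ssym.
have SS (v : 'cV[R]_k) : (v^T *m (S + S) *m v) 0 0 = (v^T *m S *m v) 0 0 *+ 2.
  by rewrite mulmxDr mulmxDl [LHS]mxE mulr2n.
split=> -[_ Spos]; split; rewrite ?linearD/= ?Ssym// => v /Spos.
  by rewrite SS pmulrn_lgt0.
by rewrite SS pmulrn_lgt0.
Qed.

(** The dynamics enter only through the linear relation between the data matrices, so the statement
    is pure matrix algebra built on the two directions of Lyapunov's theorem. *)
Lemma stabilizing_gains p q r (F : 'M[R]_p) (G : 'M[R]_(p, q))
    (Phi Delta : 'M[R]_(p, r)) (Ups : 'M[R]_(q, r)) :
  Delta = F *m Phi + G *m Ups -> row_free (col_mx Phi Ups) ->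
  let conds := fun Z : 'M[R]_(p, r) =>
    [/\ negdef (Delta *m Z^T + Z *m Delta^T), posdef (Z *m Phi^T + Phi *m Z^T) &
        Z *m Phi^T - Phi *m Z^T = 0] in
  (forall Z, conds Z -> Z *m Phi^T \in unitmx /\
     hurwitz (F + G *m (Ups *m Z^T *m invmx (Z *m Phi^T)))) /\
  (forall K, hurwitz (F + G *m K) ->
     exists Z, conds Z /\ K = Ups *m Z^T *m invmx (Z *m Phi^T)).
Proof.
move=> DeltaE free_data conds; split=> [Z [Lneg Lpos /eqP]|K Khur].
  rewrite subr_eq0 => /eqP Zsym.
  have Ssym : (Z *m Phi^T)^T = Z *m Phi^T by rewrite trmx_mul trmxK Zsym.
  have Spos : posdef (Z *m Phi^T) by apply/(posdefDD Ssym); rewrite {2}Zsym.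
  have Sunit := posdef_unitmx Spos; split=> //.
  set L := F + _; apply: (lyapunov_hurwitz Spos).
  (* The symmetry [Z Phi^T = Phi Z^T] lets [F] act on [Phi Z^T], while the inverse in the gain
     cancels against [Z Phi^T]; the sum is [Delta Z^T]. *)
  have LS : L *m (Z *m Phi^T) = Delta *m Z^T.
    by rewrite /L mulmxDl -[G *m _ *m _]mulmxA mulmxKV// Zsym DeltaE mulmxDl !mulmxA.
  have SL : Z *m Phi^T *m L^T = Z *m Delta^T.
    by rewrite -[in LHS]Ssym -trmx_mul LS trmx_mul trmxK.
  by rewrite LS SL.
have [S [Spos Lneg]] := hurwitz_lyapunov Khur.
have Ssym := Spos.1; have Sunit := posdef_unitmx Spos.
(* Full row rank makes [pinvmx] a right inverse, so [Phi Z^T = S] and [Ups Z^T = K S] hold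
   together. *)
pose Z := (pinvmx (col_mx Phi Ups) *m col_mx S (K *m S))^T.
have : col_mx Phi Ups *m Z^T = col_mx S (K *m S).
  by rewrite /Z trmxK mulmxA mulmxVp// mul1mx.
rewrite mul_col_mx => /eq_col_mx[PhiZ UpsZ].
have ZPhi : Z *m Phi^T = S by rewrite -[Z]trmxK -trmx_mul PhiZ.
have DZ : Delta *m Z^T = (F + G *m K) *m S.
  by rewrite DeltaE !mulmxDl -!mulmxA PhiZ UpsZ.
exists Z; split; last by rewrite ZPhi UpsZ mulmxK.
split; last by rewrite ZPhi PhiZ subrr.
  by rewrite DZ -[X in X *m Delta^T]trmxK -trmx_mul DZ trmx_mul Ssym.
by rewrite ZPhi PhiZ; apply/posdefDD.
Qed.

End DataDrivenLyapunov.

(** * Sampling the filter identity and conclusion *)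

Lemma samples_mulmx (R : realType) m p N (A : 'M[R]_(m, p)) (f : R -> 'cV[R]_p)
    (ts : 'I_N -> R) :
  samples (fun t => A *m f t) ts = A *m samples f ts.
Proof. by apply/matrixP => i k; rewrite !mxE; apply: eq_bigr => j _; rewrite mxE. Qed.

Lemma samplesD (R : realType) m N (f g : R -> 'cV[R]_m) (ts : 'I_N -> R) :
  samples (fun t => f t + g t) ts = samples f ts + samples g ts.
Proof. by apply/matrixP => i k; rewrite !mxE. Qed.

Theorem theorem2 (R : realType) (n : nat) (a b c : nat -> R) (beta : R)
  (x0 : 'cV[R]_n) (u : R -> R) (N : nat) (ts : 'I_N -> R) (T : R)
  (x zeta mu : R -> 'cV[R]_n) (phi : R -> 'cV[R]_(n + n)) (ups : R -> 'cV[R]_1)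
  (Nbar : nat) (W : 'M[R]_(N, Nbar)) :
  (0 < n)%N ->
  (* sampling times 0 < t_1 < ... < t_N, and T = t_N *)
  (forall k : 'I_N, 0 < ts k) ->
  (forall k l : 'I_N, (k < l)%N -> ts k < ts l) ->
  (exists k : 'I_N, ts k = T) -> (forall k : 'I_N, ts k <= T) ->
  (* locally integrable input on [0, t_N] *)
  (@lebesgue_measure R).-integrable `[0, T] (EFin \o u) ->
  (* plant and filters *)
  ode_sol (plantA n a) (plantB n b) (fun s => (u s)%:M) x0 T x ->
  ode_sol (companion n c) (Br R n) (fun s => (u s)%:M) 0 T zeta ->
  ode_sol (companion n c) (Br R n) (fun s => plantC R n *m x s) 0 T mu ->
  ode_sol (- beta%:M) 1%:M (fun s => col_mx (zeta s) (mu s)) 0 T phi ->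
  ode_sol (- beta%:M) 1%:M (fun s => (u s)%:M) 0 T ups ->
  let delta := fun t => col_mx (zeta t) (mu t) - beta *: phi t in
  let Gamma := Gf R n *m invmx ((companion n c)^T + beta%:M) in
  let eps := fun t => Gamma *m
      (mexp (companion n c)^T t *m x0 - expR (- (beta * t)) *: x0) in
  let DeltaN := samples delta ts in
  let PhiN := samples phi ts in
  let UpsN := samples ups ts in
  let EN := samples eps ts in
  (* Assumption 1 *)
  coprimep (den_poly n a) (num_poly n b) ->
  (* Assumption 2 *)
  ~~ eigenvalue (companion n c) (- beta) ->
  (* Assumption 3, with this W_N *)
  EN *m W = 0 ->
  let DeltaB := DeltaN *m W in
  let PhiB := PhiN *m W in
  let UpsB := UpsN *m W in
  \rank (col_mx PhiB UpsB) = (n + n).+1 ->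
  let conds := fun Z : 'M[R]_(n + n, Nbar) =>
    [/\ negdef (DeltaB *m Z^T + Z *m DeltaB^T),
        posdef (Z *m PhiB^T + PhiB *m Z^T) &
        Z *m PhiB^T - PhiB *m Z^T = 0] in
  (forall Z : 'M[R]_(n + n, Nbar), conds Z ->
     Z *m PhiB^T \in unitmx /\
     hurwitz (Af n a b c + Bf R n *m (UpsB *m Z^T *m invmx (Z *m PhiB^T)))) /\
  (forall K : 'rV[R]_(n + n), hurwitz (Af n a b c + Bf R n *m K) ->
     exists Z : 'M[R]_(n + n, Nbar),
       conds Z /\ K = UpsB *m Z^T *m invmx (Z *m PhiB^T)).
Proof.
case: n x0 x zeta mu phi => // m x0 x zeta mu phi _ ts0 _ [k0 tsT] tsle _.
move=> ode_x ode_zeta ode_mu ode_phi ode_ups delta Gamma eps DeltaN PhiN UpsN EN.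
move=> _ beta_noneig EW DeltaB PhiB UpsB rank_data.
(* Column [k] is the filter identity at [ts k], which lies in [[0, T]]; multiplying by [W] then
   removes [EN]. *)
have DeltaNE : DeltaN = Af m.+1 a b c *m PhiN + Bf R m.+1 *m UpsN + EN.
  rewrite /PhiN /UpsN /EN -!samples_mulmx -!samplesD; apply/matrixP => i k.
  have tk : 0 <= ts k <= T by rewrite (ltW (ts0 k)) tsle.
  rewrite [LHS]mxE [RHS]mxE /delta.
  by rewrite (filter_identity ode_x ode_zeta ode_mu ode_phi ode_ups beta_noneig tk).
apply: stabilizing_gains; last by rewrite /row_free rank_data addn1.
by rewrite /DeltaB DeltaNE !mulmxDl EW addr0 -!mulmxA.
Qed.
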